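(* Let $\mathcal{G}$ and $\mathcal{H}$ be étale groupoids over spaces $X$ and $Y$. There is a natural one-to-one correspondence between continuous morphisms of pseudogroups $\widetilde{\mathcal{G}}\to\widetilde{\mathcal{H}}$ and translation actions of $\mathcal{G}$ on $\mathcal{H}$. Under this correspondence, a continuous morphism $\varphi\colon\widetilde{\mathcal{G}}\to\widetilde{\mathcal{H}}$ with spatial component $q\colon Y\to X$ corresponds to a translation action $\mathcal{G}\curvearrowright\mathcal{H}$ over the map $q\circ\mathsf{r}\colon\mathcal{H}\to X$; explicitly, it is given by $$\gamma\cdot\delta=[\varphi(F)]_{\mathsf{r}(\delta)}\,\delta$$ for $\gamma\in\mathcal{G}$, $\delta\in\mathcal{H}$ with $q(\mathsf{r}(\delta))=\mathsf{s}(\gamma)$, where $F\in\widetilde{\mathcal{G}}$ is any bisection with $\gamma\in F$. Furthermore, this correspondence is functorial, and establishes an equivalence between the category of pseudogroups with continuous morphisms and the category of étale groupoids with translation actions as morphisms.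
   Context: An étale groupoid over a Hausdorff space $X$ is a topological groupoid $\mathcal{G}$ (not necessarily Hausdorff) with unit space $X\subset\mathcal{G}$ whose source and range maps $\mathsf{s},\mathsf{r}\colon\mathcal{G}\to X$ are open local homeomorphisms; $\gamma\delta$ is defined iff $\mathsf{s}(\gamma)=\mathsf{r}(\delta)$. A bisection is an open $T\subset\mathcal{G}$ such that $\mathsf{s}|_T,\mathsf{r}|_T$ are homeomorphisms onto their images; for $x\in\mathsf{s}(T)$, $[T]_x$ is the unique $\gamma\in T$ with $\mathsf{s}(\gamma)=x$. The set $\widetilde{\mathcal{G}}$ of bisections is an inverse monoid under $TS=\{\gamma\delta\colon\gamma\in T,\delta\in S,\mathsf{s}(\gamma)=\mathsf{r}(\delta)\}$ and $T^{-1}=\{\gamma^{-1}\colon\gamma\in T\}$, with unit $X$, zero $\varnothing$ and idempotents the open subsets of $X$; it is the pseudogroup of $\mathcal{G}$, and all pseudogroups are taken to be of the form $\widetilde{\mathcal{G}}$ for an étale groupoid $\mathcal{G}$. A family $\{F_i\}\subset\widetilde{\mathcal{G}}$ is compatible if $F_iF_j^{-1}$ and $F_i^{-1}F_j$ are idempotents for all $i,j$; then $\bigcup F_i\in\widetilde{\mathcal{G}}$. A continuous morphism $\varphi\colon\widetilde{\mathcal{G}}\to\widetilde{\mathcal{H}}$ is a semigroup homomorphism that preserves unions of compatible families, with $\varphi(\varnothing)=\varnothing$ and $\varphi(X)=Y$. Its spatial component is the unique continuous map $q\colon Y\to X$ with $\varphi(U)=q^{-1}(U)$ for every open $U\subset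 X$. A (continuous) left action of $\mathcal{G}$ on a space $Z$ over a continuous map $p\colon Z\to X$ is a continuous map $(\gamma,z)\mapsto\gamma\cdot z\in Z$, defined on $\{(\gamma,z)\in\mathcal{G}\times Z\colon\mathsf{s}(\gamma)=p(z)\}$, such that $p(\gamma\cdot z)=\mathsf{r}(\gamma)$, $(\delta\gamma)\cdot z=\delta\cdot(\gamma\cdot z)$ whenever $\mathsf{s}(\delta)=\mathsf{r}(\gamma)$ and $\mathsf{s}(\gamma)=p(z)$, and $p(z)\cdot z=z$. A translation action of $\mathcal{G}$ on $\mathcal{H}$ is a left action on the space $\mathcal{H}$ over some continuous map $p\colon\mathcal{H}\to X$ which commutes with the right multiplication of $\mathcal{H}$ on itself: whenever $\mathsf{s}(\gamma)=p(z)$ and $\mathsf{s}(z)=\mathsf{r}(\delta)$ ($\gamma\in\mathcal{G}$, $z,\delta\in\mathcal{H}$), one has $p(z\delta)=p(z)$, $\mathsf{s}(\gamma\cdot z)=\mathsf{s}(z)$ and $(\gamma\cdot z)\delta=\gamma\cdot(z\delta)$. Then $p=q\circ\mathsf{r}$ with $q=p|_Y\colon Y\to X$. For étale groupoids $\mathcal{G},\mathcal{H},\mathcal{K}$ over $X,Y,Z$ and translation actions $\alpha$ of $\mathcal{G}$ on $\mathcal{H}$ over $q\circ\mathsf{r}$ and $\beta$ of $\mathcal{H}$ on $\mathcal{K}$ over $p\circ\mathsf{r}$ (with $q\colon Y\to X$, $p\colon Z\to Y$), their composition is the translation action $\xi$ of $\mathcal{G}$ on $\mathcal{K}$ over $q\circ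 p\circ\mathsf{r}$ given by $\gamma\cdot_\xi\delta=(\gamma\cdot_\alpha p(\mathsf{r}(\delta)))\cdot_\beta\delta$. With this composition, translation actions are the morphisms of a category whose objects are étale groupoids (a translation action of $\mathcal{G}$ on $\mathcal{H}$ being a morphism from $\mathcal{G}$ to $\mathcal{H}$); the identity of $\mathcal{G}$ is left multiplication. *)

(* Defs.v *)
From mathcomp Require Import all_boot.
From mathcomp Require Import boolp classical_sets functions topology.

Set Implicit Arguments.
Unset Strict Implicit.
Unset Printing Implicit Defensive.

Local Open Scope classical_set_scope.

(* [f] restricts to a homeomorphism of [A] onto [f @` A]; the last clause says
   that the inverse is continuous for the relative topologies. *)
Definition homeo_on (S T : topologicalType) (f : S -> T) (A : set S) : Prop :=
  [/\ {within A, continuous f}, set_inj A f &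
      forall U, open U -> exists2 V, open V & f @` (A `&` U) = f @` A `&` V].

Definition local_homeo (S T : topologicalType) (f : S -> T) : Prop :=
  forall x, exists U, [/\ open U, U x, open (f @` U) & homeo_on f U].

Definition open_map (S T : topologicalType) (f : S -> T) : Prop :=
  forall U, open U -> open (f @` U).

Definition fibered (S T B : Type) (f : S -> B) (g : T -> B) : set (S * T) :=
  [set x | f x.1 = g x.2].

(* The unit space is presented by the map [unit_at] rather than as a subset of
   [arrow]: since [src \o unit_at = id], [unit_at] is a homeomorphism onto its range,
   and [x : base] is identified with [unit_at x].  Products are defined on
   composable pairs only, and the domain of the multiplication carries the
   topology induced by the product topology.  [arrow] need not be Hausdorff. *)
Record etale_groupoid := EtaleGroupoid {
  arrow : topologicalType;
  base : topologicalType;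
  base_hausdorff : hausdorff_space base;
  src : arrow -> base;
  rng : arrow -> base;
  unit_at : base -> arrow;
  ginv : arrow -> arrow;
  gmul : forall g h : arrow, src g = rng h -> arrow;
  src_unit : forall x, src (unit_at x) = x;
  rng_unit : forall x, rng (unit_at x) = x;
  src_mul : forall g h (e : src g = rng h), src (gmul e) = src h;
  rng_mul : forall g h (e : src g = rng h), rng (gmul e) = rng g;
  mulA : forall g h k (e1 : src g = rng h) (e2 : src h = rng k)
           (e3 : src (gmul e1) = rng k) (e4 : src g = rng (gmul e2)),
    gmul e3 = gmul e4;
  mul1g : forall g (e : src (unit_at (rng g)) = rng g), gmul e = g;
  mulg1 : forall g (e : src g = rng (unit_at (src g))), gmul e = g;
  src_inv : forall g, src (ginv g) = rng g;
  rng_inv : forall g, rng (ginv g) = src g;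
  mulVg : forall g (e : src (ginv g) = rng g), gmul e = unit_at (src g);
  mulgV : forall g (e : src g = rng (ginv g)), gmul e = unit_at (rng g);
  unit_continuous : continuous unit_at;
  inv_continuous : continuous ginv;
  mul_continuous :
    continuous (fun x : fibered src rng => gmul (set_valP x));
  src_local_homeo : local_homeo src;
  src_open : open_map src;
  rng_local_homeo : local_homeo rng;
  rng_open : open_map rng
}.

Definition is_bisection (G : etale_groupoid) (T : set (arrow G)) : Prop :=
  [/\ open T, homeo_on (@src G) T & homeo_on (@rng G) T].

Record bisection (G : etale_groupoid) := Bisection {
  pts :> set (arrow G);
  bisectionP : is_bisection pts
}.

Definition mul_set (G : etale_groupoid) (T S : set (arrow G)) : set (arrow G) :=
  [set g | exists a b (e : src a = rng b), [/\ T a, S b & g = gmul e]].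

Lemma bisection_ext (G : etale_groupoid) (T S : bisection G) :
  (T : set _) = S -> T = S.
Proof.
case: T S => [T pT] [S pS] /= TS; move: pT; rewrite TS => pT.
by congr Bisection; exact: Prop_irrelevance.
Qed.

Lemma local_homeo_continuous (S T : topologicalType) (f : S -> T) :
  local_homeo f -> continuous f.
Proof.
move=> lf x; have [U [oU Ux _ [cf _ _]]] := lf x.
move: cf; rewrite continuous_open_subspace //; apply; exact/mem_set.
Qed.

Lemma homeo_on_open (S T : topologicalType) (f : S -> T) (A : set S) :
  local_homeo f -> open_map f -> open A -> set_inj A f -> homeo_on f A.
Proof.
move=> lf of_ oA fA; split => //.
  exact/continuous_subspaceT/local_homeo_continuous.
move=> U oU; exists (f @` (A `&` U)); first by apply: of_; exact: openI.
apply/seteqP; split=> [y [x [Ax Ux] <-]|y []//].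
by split; exists x.
Qed.

Section EtaleGroupoidTheory.
Variable G : etale_groupoid.
Implicit Types (g h : arrow G) (T S : set (arrow G)).

Lemma src_continuous : continuous (@src G).
Proof. exact/local_homeo_continuous/src_local_homeo. Qed.

Lemma rng_continuous : continuous (@rng G).
Proof. exact/local_homeo_continuous/rng_local_homeo. Qed.

Lemma is_bisectionP T :
  is_bisection T <-> [/\ open T, set_inj T (@src G) & set_inj T (@rng G)].
Proof.
split=> [[oT [_ ? _] [_ ? _]]//|[oT sT rT]]; split => //.
  by apply: homeo_on_open => //; [exact: src_local_homeo|exact: src_open].
by apply: homeo_on_open => //; [exact: rng_local_homeo|exact: rng_open].
Qed.

Lemma src_bisection_inj (T : bisection G) g h :
  pts T g -> pts T h -> src g = src h -> g = h.
Proof.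
move=> Tg Th; have /is_bisectionP[_ /(_ g h)] := bisectionP T.
by rewrite !in_setE => /(_ Tg Th).
Qed.

Lemma rng_bisection_inj (T : bisection G) g h :
  pts T g -> pts T h -> rng g = rng h -> g = h.
Proof.
move=> Tg Th; have /is_bisectionP[_ _ /(_ g h)] := bisectionP T.
by rewrite !in_setE => /(_ Tg Th).
Qed.

Lemma bisection_open (T : bisection G) : open (T : set _).
Proof. by case: (bisectionP T). Qed.

Lemma mul_congr g g' h h' (e : src g = rng h) (e' : src g' = rng h') :
  g = g' -> h = h' -> gmul e = gmul e'.
Proof.
by move=> gg' hh'; subst g' h'; congr gmul; exact: Prop_irrelevance.
Qed.

Lemma mul_unitl x g (e : src (unit_at x) = rng g) : gmul e = g.
Proof.
have xg : x = rng g by rewrite -e src_unit.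
by subst x; exact: mul1g.
Qed.

Lemma mul_unitr x g (e : src g = rng (unit_at x)) : gmul e = g.
Proof.
have xg : x = src g by rewrite e rng_unit.
by subst x; exact: mulg1.
Qed.

Lemma mulK g h (e : src g = rng h) (e' : src (gmul e) = rng (ginv h)) :
  gmul e' = g.
Proof.
have e1 : src h = rng (ginv h) by rewrite rng_inv.
have e2 : src g = rng (gmul e1) by rewrite rng_mul.
rewrite (mulA e' e2).
have e3 : src g = rng (unit_at (rng h)) by rewrite rng_unit.
by rewrite (mul_congr e2 e3) ?mul_unitr ?mulgV.
Qed.

Lemma mulVK g h (e : src g = rng (ginv h)) (e' : src (gmul e) = rng h) :
  gmul e' = g.
Proof.
have e1 : src (ginv h) = rng h by rewrite src_inv.
have e2 : src g = rng (gmul e1) by rewrite rng_mul.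
rewrite (mulA e' e2).
have e3 : src g = rng (unit_at (src h)) by rewrite rng_unit -(rng_inv h).
by rewrite (mul_congr e2 e3) ?mul_unitr ?mulVg.
Qed.

Lemma mulKV g h (e : src (ginv g) = rng (h)) (e' : src g = rng (gmul e)) :
  gmul e' = h.
Proof.
have e1 : src g = rng (ginv g) by rewrite rng_inv.
have e2 : src (gmul e1) = rng h by rewrite src_mul.
rewrite -(mulA e2 e').
have e3 : src (unit_at (rng g)) = rng h by rewrite src_unit -(src_inv g).
by rewrite (mul_congr e2 e3) ?mul_unitl ?mulgV.
Qed.

Lemma invK g : ginv (ginv g) = g.
Proof.
have e : src (ginv (ginv g)) = rng (ginv g) by rewrite src_inv.
have e' : src (gmul e) = rng g by rewrite src_mul src_inv.
rewrite -(mulVK e') .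
have e'' : src (unit_at (rng g)) = rng g by rewrite src_unit.
rewrite (mul_congr e' e'') ?mul_unitl//.
by rewrite mulVg src_inv.
Qed.

Lemma set_type_nbhs (S T : topologicalType) (A : set S) (f : A -> T) (x : A)
    (O : set T) :
  continuous f -> open O -> O (f x) ->
  exists U, [/\ open U, U (val x) & forall y : A, U (val y) -> O (f y)].
Proof.
move=> cf oO Ofx; have : open (f @^-1` O) by move/continuousP: cf; apply.
move=> [U oU UE]; exists U; split=> [//||y Uy].
  by have : (f @^-1` O) x by []; rewrite -UE.
by have : (set_val @^-1` U) y by []; rewrite UE.
Qed.

Lemma fibered_nbhs (S T B Z : topologicalType) (f : S -> B) (g : T -> B)
    (m : fibered f g -> Z) (x : fibered f g) (O : set Z) :
  continuous m -> open O -> O (m x) ->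
  exists A C, [/\ open A, open C, A (val x).1, C (val x).2 &
    forall y : fibered f g, A (val y).1 -> C (val y).2 -> O (m y)].
Proof.
move=> cm oO /(set_type_nbhs cm oO)[U [oU Ux UO]].
have : nbhs (val x) U by exact: open_nbhs_nbhs.
case=> -[A C] /= []; rewrite !nbhsE => -[A' [oA' A'x] A'A] [C' [oC' C'x] C'C] ACU.
exists A', C'; split => // y A'y C'y; apply/UO/ACU.
by split; [exact: A'A|exact: C'C].
Qed.

Lemma mul_nbhs g h (e : src g = rng h) (O : set (arrow G)) :
  open O -> O (gmul e) ->
  exists A C, [/\ open A, open C, A g, C h &
    forall a c (e' : src a = rng c), A a -> C c -> O (gmul e')].
Proof.
move=> oO Oe.
have gh : (g, h) \in fibered (@src G) (@rng G) by exact/mem_set.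
pose x : fibered (@src G) (@rng G) := exist _ (g, h) gh.
have Ox : O (gmul (set_valP x)) by rewrite (mul_congr _ e).
have [A [C [oA oC Ag Ch H]]] := fibered_nbhs (@mul_continuous G) oO Ox.
exists A, C; split => // a c e' Aa Cc.
have ac : (a, c) \in fibered (@src G) (@rng G) by exact/mem_set.
have := H (exist _ (a, c) ac) Aa Cc.
by rewrite (mul_congr _ e').
Qed.

End EtaleGroupoidTheory.

Lemma unit_open (G : etale_groupoid) : open_map (@unit_at G).
Proof.
move=> U oU; rewrite openE => _ [x Ux <-].
have [N [oN Nx _ [_ sN _]]] := src_local_homeo (unit_at x).
rewrite /interior nbhsE.
exists (N `&` (@src G @^-1` (U `&` @unit_at G @^-1` N))).
  split; last by split => //=; rewrite src_unit.
  apply: openI => //; apply: (continuousP _).1; first exact: src_continuous.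
  by apply: openI => //; apply: (continuousP _).1 => //; exact: unit_continuous.
move=> g [Ng [Ug Nug]]; exists (src g) => //.
by apply: sN; rewrite ?in_setE// src_unit.
Qed.

Lemma unit_bisection_subproof (G : etale_groupoid) (U : set (base G)) :
  open U -> is_bisection (@unit_at G @` U).
Proof.
move=> oU; apply/is_bisectionP; split; first exact: unit_open.
  by move=> _ _ /[!in_setE] -[x _ <-] [y _ <-]; rewrite !src_unit => ->.
by move=> _ _ /[!in_setE] -[x _ <-] [y _ <-]; rewrite !rng_unit => ->.
Qed.

Definition unit_bisection (G : etale_groupoid) (U : set (base G)) (oU : open U) :
  bisection G := Bisection (unit_bisection_subproof oU).

Lemma empty_bisection_subproof (G : etale_groupoid) :
  is_bisection (@set0 (arrow G)).
Proof.
by apply/is_bisectionP; split; [exact: open0| |] => x y; rewrite in_setE.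
Qed.

Lemma mul_bisection_subproof (G : etale_groupoid) (T S : bisection G) :
  is_bisection (mul_set T S).
Proof.
apply/is_bisectionP; split.
- rewrite openE => _ [a [b [e [Ta Sb ->]]]]; rewrite /interior nbhsE.
  have e1 : src (gmul e) = rng (ginv b) by rewrite src_mul rng_inv.
  have Te1 : pts T (gmul e1) by rewrite mulK.
  have [A [C [oA oC Ae Cb AC]]] := mul_nbhs (bisection_open T) Te1.
  exists (A `&` (@src G @^-1` (@src G @` (S `&` (@ginv G @^-1` C))))).
    split; last by split => //; exists b => //; rewrite src_mul.
    apply: openI => //; apply: (continuousP _).1; first exact: src_continuous.
    apply: src_open; apply: openI; first exact: bisection_open.
    by apply: (continuousP _).1 => //; exact: inv_continuous.
  move=> g [Ag [d [Sd Cd] dg]].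
  have e2 : src g = rng (ginv d) by rewrite rng_inv.
  have e3 : src (gmul e2) = rng d by rewrite src_mul src_inv.
  by exists (gmul e2), d, e3; split => //; [exact: AC|rewrite mulVK].
- move=> _ _ /[!in_setE] -[a [b [e [Ta Sb ->]]]] [a' [b' [e' [Ta' Sb' ->]]]].
  rewrite !src_mul => bb'; have {bb'} ? := src_bisection_inj Sb Sb' bb'; subst b'.
  by apply: mul_congr => //; apply: (src_bisection_inj Ta Ta'); rewrite e e'.
- move=> _ _ /[!in_setE] -[a [b [e [Ta Sb ->]]]] [a' [b' [e' [Ta' Sb' ->]]]].
  rewrite !rng_mul => aa'; have {aa'} ? := rng_bisection_inj Ta Ta' aa'; subst a'.
  by apply: mul_congr => //; apply: (rng_bisection_inj Sb Sb'); rewrite -e -e'.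
Qed.

Lemma inv_bisection_subproof (G : etale_groupoid) (T : bisection G) :
  is_bisection (@ginv G @` T).
Proof.
have TE : @ginv G @` T = @ginv G @^-1` T.
  apply/seteqP; split=> [_ [g Tg <-]|g Tg]; first by rewrite /preimage /= invK.
  by exists (ginv g) => //; rewrite invK.
apply/is_bisectionP; split.
- rewrite TE; apply: (continuousP _).1; first exact: inv_continuous.
  exact: bisection_open.
- move=> _ _ /[!in_setE] -[a Ta <-] [b Tb <-]; rewrite !src_inv => ab.
  by rewrite (rng_bisection_inj Ta Tb ab).
- move=> _ _ /[!in_setE] -[a Ta <-] [b Tb <-]; rewrite !rng_inv => ab.
  by rewrite (src_bisection_inj Ta Tb ab).
Qed.

(* [section_at hx] is [T]_x, for [x] in the source of [T]. *)
Definition section_at (G : etale_groupoid) (T : bisection G) (x : base G)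
  (hx : (@src G @` T) x) : arrow G := s2val (cid2 hx).

Lemma section_at_mem (G : etale_groupoid) (T : bisection G) (x : base G)
  (hx : (@src G @` T) x) : pts T (section_at hx).
Proof. exact: s2valP (cid2 hx). Qed.

Lemma src_section_at (G : etale_groupoid) (T : bisection G) (x : base G)
  (hx : (@src G @` T) x) : src (section_at hx) = x.
Proof. exact: s2valP' (cid2 hx). Qed.

(* [pg_union C a] means that [a] is the union of the family [C]; it is a
   relation because incompatible families need not have a union.  A family
   enters only through the set of its members. *)
Record pg_data := PgData {
  pg_sort :> Type;
  pg_mul : pg_sort -> pg_sort -> pg_sort;
  pg_inv : pg_sort -> pg_sort;
  pg_one : pg_sort;
  pg_zero : pg_sort;
  pg_union : set pg_sort -> pg_sort -> Prop
}.

Definition bisections (G : etale_groupoid) : pg_data := {|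
  pg_sort := bisection G;
  pg_mul := fun T S => Bisection (mul_bisection_subproof T S);
  pg_inv := fun T => Bisection (inv_bisection_subproof T);
  pg_one := unit_bisection openT;
  pg_zero := Bisection (@empty_bisection_subproof G);
  pg_union := fun C T => pts T = \bigcup_(S in C) S
|}.

(* A pseudogroup does not carry the groupoid it comes from. *)
Record pseudogroup := Pseudogroup {
  pseudogroup_data :> pg_data;
  pseudogroupP : exists G, pseudogroup_data = bisections G
}.

Definition pseudogroup_of (G : etale_groupoid) : pseudogroup :=
  @Pseudogroup (bisections G) (ex_intro _ G erefl).

Definition pg_idempotent (P : pg_data) (a : P) : Prop := pg_mul a a = a.

Definition compatible (P : pg_data) (C : set P) : Prop :=
  forall a b, C a -> C b ->
    pg_idempotent (pg_mul a (pg_inv b)) /\ pg_idempotent (pg_mul (pg_inv a) b).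

Record continuous_morphism (P Q : pg_data) := ContinuousMorphism {
  cm_fun :> P -> Q;
  cm_mul : forall a b, cm_fun (pg_mul a b) = pg_mul (cm_fun a) (cm_fun b);
  cm_union : forall (C : set P) a,
    compatible C -> pg_union C a -> pg_union (cm_fun @` C) (cm_fun a);
  cm_zero : cm_fun (pg_zero P) = pg_zero Q;
  cm_one : cm_fun (pg_one P) = pg_one Q
}.

Lemma inv_unique (G : etale_groupoid) (a b : arrow G) (e : src a = rng b)
  (e' : src (gmul e) = rng a) : gmul e' = a -> b = ginv a.
Proof.
move=> aba.
have e1 : src (gmul e') = rng (ginv a) by rewrite src_mul rng_inv.
have e2 : src a = rng (ginv a) by rewrite rng_inv.
have ab1 : gmul e = unit_at (rng a).
  by rewrite -(mulgV e2) -(mulK e1); exact: mul_congr.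
have e3 : src (ginv (ginv a)) = rng b by rewrite invK.
have e4 : src (ginv a) = rng (gmul e3) by rewrite rng_mul src_inv rng_inv src_inv.
rewrite -(mulKV e4).
have e5 : src (ginv a) = rng (unit_at (rng a)) by rewrite rng_unit src_inv.
rewrite (mul_congr e4 e5) ?mul_unitr// -ab1.
by apply: mul_congr => //; exact: invK.
Qed.

Lemma pg_mulVK (P : pseudogroup) (a : P) : pg_mul (pg_mul a (pg_inv a)) a = a.
Proof.
case: P a => P [G PE]; subst P => T; apply: bisection_ext => /=.
apply/seteqP; split=> [_ [x [c [e' [[a [y [e [Ta [b Tb yE] xE]]]] Tc ->]]]]|g Tg].
  subst x; subst y.
  have ? : a = b by apply: (src_bisection_inj Ta Tb); rewrite e rng_inv.
  subst b.
  have ? : a = c by apply: (rng_bisection_inj Ta Tc); rewrite -e' src_mul src_inv.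
  subst c.
  by rewrite mulVK.
have e : src g = rng (ginv g) by rewrite rng_inv.
have e' : src (gmul e) = rng g by rewrite src_mul src_inv.
exists (gmul e), g, e'; split => //; first by exists g, (ginv g), e; split => //; exists g.
by rewrite mulVK.
Qed.

Lemma pg_inv_mulV (P : pseudogroup) (a : P) :
  pg_mul (pg_mul (pg_inv a) a) (pg_inv a) = pg_inv a.
Proof.
suff {2}-> : a = pg_inv (pg_inv a) by exact: pg_mulVK.
case: P a => P [G PE]; subst P => T; apply: bisection_ext => /=.
apply/seteqP; split=> [g Tg|_ [_ [g Tg <-] <-]]; last by rewrite invK.
by exists (ginv g); [exists g|rewrite invK].
Qed.

Lemma pg_inv_unique (P : pseudogroup) (a b : P) :
  pg_mul (pg_mul a b) a = a -> pg_mul (pg_mul b a) b = b -> b = pg_inv a.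
Proof.
case: P a b => P [G PE]; subst P => T S TST STS; apply: bisection_ext.
move: (congr1 (@pts G) TST) (congr1 (@pts G) STS) => /= {}TST {}STS.
have sub (A B : bisection G) :
    mul_set (mul_set A B) A = A -> forall a, pts A a -> pts B (ginv a).
  move=> ABA a Aa; move: (Aa); rewrite -ABA.
  move=> [x [a2 [e' [[a1 [b [e [Aa1 Bb xE]]]] Aa2 aE]]]]; subst x.
  have ? : a = a2 by apply: (src_bisection_inj Aa Aa2); rewrite aE src_mul.
  have ? : a = a1.
    by apply: (rng_bisection_inj Aa Aa1); rewrite aE !rng_mul.
  by subst a1 a2; rewrite -(inv_unique (esym aE)).
apply/seteqP; split=> [s Ss|_ [t Tt <-]]; last exact: sub TST _ Tt.
by exists (ginv s); [exact: sub STS _ Ss|rewrite invK].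
Qed.

Section ContinuousMorphismTheory.
Variables (P Q : pseudogroup) (phi : continuous_morphism P Q).

Lemma cm_inv (a : P) : phi (pg_inv a) = pg_inv (phi a).
Proof.
by apply: pg_inv_unique; rewrite -!cm_mul ?pg_mulVK ?pg_inv_mulV.
Qed.

Lemma cm_compatible (C : set P) : compatible C -> compatible (phi @` C).
Proof.
move=> cC _ _ [a Ca <-] [b Cb <-]; have [ab ba] := cC a b Ca Cb.
by rewrite /pg_idempotent -!cm_inv -!cm_mul ab ba.
Qed.

End ContinuousMorphismTheory.

Lemma cm_ext (P Q : pg_data) (phi psi : continuous_morphism P Q) :
  (forall a, phi a = psi a) -> phi = psi.
Proof.
case: phi psi => f ? ? ? ? [g ? ? ? ?] /= /funext fg; subst g.
by congr ContinuousMorphism; exact: Prop_irrelevance.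
Qed.

Definition cm_id (P : pg_data) : continuous_morphism P P.
Proof.
by exists id => // C a _; rewrite image_id.
Defined.

Definition cm_comp (P Q R : pseudogroup) (psi : continuous_morphism Q R)
  (phi : continuous_morphism P Q) : continuous_morphism P R.
Proof.
exists (psi \o phi) => [a b|C a cC Ca||] /=.
- by rewrite !cm_mul.
- rewrite -image_comp; apply: cm_union; first exact: cm_compatible.
  exact: cm_union.
- by rewrite !cm_zero.
- by rewrite !cm_one.
Defined.

Definition is_spatial_component (G H : etale_groupoid)
    (phi : continuous_morphism (bisections G) (bisections H))
    (q : base H -> base G) : Prop :=
  continuous q /\
  forall U (oU : open U), pts (phi (unit_bisection oU)) = @unit_at H @` (q @^-1` U).

Section SpatialComponent.
Variables (G H : etale_groupoid).
Variable phi : continuous_morphism (bisections G) (bisections H).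

Lemma unit_bisection_idempotent (U : set (base G)) (oU : open U) :
  pg_idempotent (unit_bisection oU : bisections G).
Proof.
apply: bisection_ext => /=; apply/seteqP; split.
  move=> _ [a [b [e [[x Ux xE] [y Uy yE] ->]]]]; subst a b.
  by rewrite mul_unitl; exists y.
move=> _ [x Ux <-]; have e : src (unit_at x) = rng (unit_at x).
  by rewrite src_unit rng_unit.
by exists (unit_at x), (unit_at x), e; split; [exists x|exists x|rewrite mul_unitl].
Qed.

Lemma idempotent_unit (T : bisections H) (g : arrow H) :
  pg_idempotent T -> pts T g -> unit_at (src g) = g.
Proof.
move=> TT Tg; have : pts (pg_mul T T) g by rewrite TT.
move=> /= [a [b [e [Ta Tb gE]]]].
have ? : g = b by apply: (src_bisection_inj Tg Tb); rewrite gE src_mul.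
have ? : g = a by apply: (rng_bisection_inj Tg Ta); rewrite gE rng_mul.
subst a b; have e1 : src (gmul e) = rng (ginv g) by rewrite src_mul rng_inv.
have e2 : src g = rng (ginv g) by rewrite rng_inv.
have : gmul e1 = gmul e2 by apply: mul_congr.
by rewrite mulK mulgV => {2}->; rewrite e.
Qed.

Lemma mul_unit_bisection (U V : set (base G)) (oU : open U) (oV : open V)
    (oUV : open (U `&` V)) :
  pg_mul (unit_bisection oU : bisections G) (unit_bisection oV) =
  unit_bisection oUV.
Proof.
apply: bisection_ext => /=; apply/seteqP; split.
  move=> _ [a [b [e [[x Ux xE] [y Vy yE] ->]]]]; subst a b.
  by rewrite mul_unitl; exists y => //; split => //; move: e;
     rewrite src_unit rng_unit => <-.
move=> _ [x [Ux Vx] <-]; have e : src (unit_at x) = rng (unit_at x).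
  by rewrite src_unit rng_unit.
by exists (unit_at x), (unit_at x), e; split; [exists x|exists x|rewrite mul_unitl].
Qed.

Lemma inv_unit (x : base G) : ginv (unit_at x) = unit_at x.
Proof.
have e : src (unit_at x) = rng (unit_at x) by rewrite src_unit rng_unit.
have e' : src (gmul e) = rng (unit_at x) by rewrite src_mul src_unit rng_unit.
by apply/esym/(@inv_unique _ _ _ e e'); rewrite mul_unitr mul_unitl.
Qed.

Lemma inv_unit_bisection (U : set (base G)) (oU : open U) :
  pg_inv (unit_bisection oU : bisections G) = unit_bisection oU.
Proof.
apply: bisection_ext => /=; apply/seteqP; split.
  by move=> _ [_ [x Ux <-] <-]; rewrite inv_unit; exists x.
by move=> _ [x Ux <-]; exists (unit_at x); [exists x|rewrite inv_unit].
Qed.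

Lemma cm_unit_sub (U : set (base G)) (oU : open U) (g : arrow H) :
  pts (phi (unit_bisection oU)) g -> unit_at (src g) = g.
Proof.
apply: idempotent_unit; rewrite /pg_idempotent -cm_mul.
by rewrite unit_bisection_idempotent.
Qed.

Lemma cm_unit_bigcup (F : set (set (base G))) (y : base H)
    (oF : forall U, F U -> open U) (oS : open (\bigcup_(U in F) U)) :
  pts (phi (unit_bisection oS)) (unit_at y) ->
  exists U (oU : open U), F U /\ pts (phi (unit_bisection oU)) (unit_at y).
Proof.
pose C : set (bisections G) :=
  [set T | exists U (oU : open U), F U /\ T = unit_bisection oU].
have cC : compatible C.
  move=> _ _ [U [oU [_ ->]]] [V [oV [_ ->]]]; have oUV := openI oU oV.
  by rewrite !inv_unit_bisection (mul_unit_bisection _ _ oUV); split;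
     exact: unit_bisection_idempotent.
have CS : pg_union C (unit_bisection oS).
  apply/seteqP; split=> [_ [x [U FU Ux] <-]|g].
    by exists (unit_bisection (oF U FU)); [exists U, (oF U FU)|exists x].
  by move=> [_ [U [oU [FU ->]]] [x Ux <-]]; exists x => //; exists U.
have /= -> := cm_union phi cC CS.
by move=> [_ [_ [U [oU [FU ->]]] <-] yU]; exists U, oU.
Qed.

Lemma cm_unit_le (U V : set (base G)) (oU : open U) (oV : open V) :
  U `<=` V -> pts (phi (unit_bisection oU)) `<=` pts (phi (unit_bisection oV)).
Proof.
move=> UV g gU; have oUV : open (U `&` V) by exact: openI.
have E : unit_bisection oU = unit_bisection oUV.
  by apply: bisection_ext => /=; rewrite (setIidl UV).
have := gU; rewrite E -(mul_unit_bisection oU oV oUV) cm_mul /=.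
move=> [a [b [e [aU bV ->]]]].
by rewrite -(cm_unit_sub aU) in e *; rewrite mul_unitl.
Qed.

Lemma spatial_component_point (y : base H) :
  exists x, forall U (oU : open U),
    pts (phi (unit_bisection oU)) (unit_at y) <-> U x.
Proof.
pose F : set (set (base G)) := [set U | exists oU : open U,
  ~ pts (phi (unit_bisection oU)) (unit_at y)].
have oF U : F U -> open U by case.
have oS : open (\bigcup_(U in F) U) by exact: bigcup_open.
have [x xS] : exists x, ~ (\bigcup_(U in F) U) x.
  apply/existsNP => allS.
  have : pts (phi (pg_one (bisections G))) (unit_at y).
    by rewrite cm_one; exists y.
  have oT : open [set: base G] := openT.
  have -> : pg_one (bisections G) = unit_bisection oS.
    by apply: bisection_ext => /=; congr image; apply/seteqP; split.
  move=> /(cm_unit_bigcup oF)[U [oU [[oU' +] yU]]]; apply.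
  by rewrite (Prop_irrelevance oU' oU).
have inx U (oU : open U) : U x -> pts (phi (unit_bisection oU)) (unit_at y).
  by move=> Ux; apply/not_notP => yU; apply: xS; exists U => //; exists oU.
exists x => U oU; split=> [yU|]; last exact: inx.
apply/not_notP => Ux.
pose F' : set (set (base G)) := [set V | open V /\ exists W, [/\ open W, W x & W `&` V = set0]].
have oF' V : F' V -> open V by case.
have oS' : open (\bigcup_(V in F') V) by exact: bigcup_open.
have US' : U `<=` \bigcup_(V in F') V.
  move=> z Uz; have zx : z != x by apply/eqP => zx; apply: Ux; rewrite -zx.
  have := @base_hausdorff G; rewrite open_hausdorff => /(_ z x zx).
  move=> [[A B] /= [/set_mem Az /set_mem Bx] [oA oB /eqP AB]].
  by exists A => //; split => //; exists B; split => //; rewrite setIC.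
have /(cm_unit_bigcup oF')[V [oV [[_ [W [oW Wx WV]]] yV]]] :=
  @cm_unit_le _ _ oU oS' US' _ yU.
have yW := inx W oW Wx.
have e : src (unit_at y) = rng (unit_at y) by rewrite src_unit rng_unit.
have : pts (phi (pg_mul (unit_bisection oW : bisections G) (unit_bisection oV))) (unit_at y).
  by rewrite cm_mul; exists (unit_at y), (unit_at y), e; split => //; rewrite mul_unitl.
have -> : pg_mul (unit_bisection oW : bisections G) (unit_bisection oV) = pg_zero _.
  have oWV : open (W `&` V) by exact: openI.
  by rewrite (mul_unit_bisection _ _ oWV); apply: bisection_ext => /=; rewrite WV image_set0.
by rewrite cm_zero.
Qed.

Lemma spatial_component_ex : exists! q, is_spatial_component phi q.
Proof.
have [q qP] := choice spatial_component_point.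
have qE U (oU : open U) :
    pts (phi (unit_bisection oU)) = @unit_at H @` (q @^-1` U).
  apply/seteqP; split=> [g gU|_ [y qyU <-]]; last exact/qP.
  exists (src g); last exact: cm_unit_sub gU.
  by apply/qP; rewrite (cm_unit_sub gU).
exists q; split.
  split => //; apply/continuousP => U oU.
  have -> : q @^-1` U = @unit_at H @^-1` (phi (unit_bisection oU)).
    by apply/seteqP; split=> y; [move=> Uqy; exact/(qP y U oU)|move/(qP y U oU)].
  apply: (continuousP _).1; first exact: unit_continuous.
  exact: bisection_open.
move=> q' [_ q'E]; apply/funext => y; apply: contrapT => /eqP qq'.
have := @base_hausdorff G; rewrite open_hausdorff => /(_ _ _ qq').
move=> [[A B] /= [/set_mem Aq /set_mem Bq'] [oA oB /eqP AB]].
have : pts (phi (unit_bisection oA)) (unit_at y) by rewrite qE; exists y.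
rewrite q'E => -[y' Ay' /(congr1 (@src H))]; rewrite !src_unit => yy'.
by subst y'; have : set0 (q' y) by rewrite -AB; split.
Qed.

Definition spatial_component : base H -> base G := sval (cid spatial_component_ex).

Lemma spatial_componentP : is_spatial_component phi spatial_component.
Proof. by rewrite /spatial_component; case: cid => q []. Qed.

End SpatialComponent.

Record left_action (G : etale_groupoid) (Z : topologicalType) := LeftAction {
  anchor : Z -> base G;
  act : forall (g : arrow G) (z : Z), src g = anchor z -> Z;
  anchor_continuous : continuous anchor;
  act_continuous :
    continuous (fun x : fibered (@src G) anchor => act (set_valP x));
  anchor_act : forall g z (e : src g = anchor z), anchor (act e) = rng g;
  act_mul : forall h g z (e1 : src h = rng g) (e2 : src g = anchor z)
                (e3 : src (gmul e1) = anchor z) (e4 : src h = anchor (act e2)),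
    act e3 = act e4;
  act_unit : forall z (e : src (unit_at (anchor z)) = anchor z), act e = z
}.

Record translation_action (G H : etale_groupoid) := TranslationAction {
  ta_action :> left_action G (arrow H);
  ta_anchor_mul : forall (z d : arrow H) (e : src z = rng d),
    anchor ta_action (gmul e) = anchor ta_action z;
  ta_src_act : forall (g : arrow G) (z : arrow H) (e : src g = anchor ta_action z),
    src (act e) = src z;
  ta_mul_act : forall (g : arrow G) (z d : arrow H)
      (e1 : src g = anchor ta_action z) (e2 : src z = rng d)
      (e3 : src (act e1) = rng d) (e4 : src g = anchor ta_action (gmul e2)),
    gmul e3 = act e4
}.

Section ActionTheory.
Variables (G : etale_groupoid) (Z : topologicalType) (alpha : left_action G Z).

Lemma act_congr g g' z z' (e : src g = anchor alpha z)
    (e' : src g' = anchor alpha z') : g = g' -> z = z' -> act e = act e'.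
Proof.
by move=> gg' zz'; subst g' z'; congr act; exact: Prop_irrelevance.
Qed.

Lemma act_unitl x z (e : src (unit_at x) = anchor alpha z) : act e = z.
Proof.
have xz : x = anchor alpha z by rewrite -e src_unit.
by subst x; exact: act_unit.
Qed.

End ActionTheory.

Lemma ta_ext (G H : etale_groupoid) (alpha beta : translation_action G H) :
  anchor alpha = anchor beta ->
  (forall g z (e : src g = anchor alpha z) (e' : src g = anchor beta z),
    act e = act e') -> alpha = beta.
Proof.
case: alpha beta => [[p a x1 x2 x3 x4 x5] x6 x7 x8].
move=> [[q b y1 y2 y3 y4 y5] y6 y7 y8] /= pq ab.
subst q; have {}ab : a = b.
  by do 3![apply/functional_extensionality_dep=> ?]; exact: ab.
subst b; have ? := Prop_irrelevance x1 y1; have ? := Prop_irrelevance x2 y2.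
have ? := Prop_irrelevance x3 y3; have ? := Prop_irrelevance x4 y4.
have ? := Prop_irrelevance x5 y5; subst y1 y2 y3 y4 y5.
by congr TranslationAction; exact: Prop_irrelevance.
Qed.

(* The map [q] with [anchor alpha = q \o rng]. *)
Definition ta_base (G H : etale_groupoid) (alpha : translation_action G H) :
  base H -> base G := anchor alpha \o @unit_at H.

Lemma ta_baseE (G H : etale_groupoid) (alpha : translation_action G H) z :
  anchor alpha z = ta_base alpha (rng z).
Proof.
have e : src (unit_at (rng z)) = rng z by rewrite src_unit.
by rewrite /ta_base /= -(ta_anchor_mul alpha e) mul_unitl.
Qed.

Lemma ta_base_continuous (G H : etale_groupoid) (alpha : translation_action G H) :
  continuous (ta_base alpha).
Proof.
move=> y; apply: continuous_comp; first exact: unit_continuous.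
exact: anchor_continuous.
Qed.

Definition ta_id (G : etale_groupoid) : translation_action G G.
Proof.
unshelve refine (@TranslationAction G G
  (@LeftAction G (arrow G) (@rng G) (@gmul G) _ _ _ _ _) _ _ _).
- exact: rng_continuous.
- exact: mul_continuous.
- exact: rng_mul.
- exact: mulA.
- exact: mul1g.
- exact: rng_mul.
- exact: src_mul.
- by move=> g z d e1 e2 e3 e4; exact: mulA.
Defined.

Lemma continuous_pair (S T U : topologicalType) (f : S -> T) (g : S -> U) :
  continuous f -> continuous g -> continuous (fun x => (f x, g x)).
Proof. by move=> cf cg x; apply: cvg_pair; [exact: cf|exact: cg]. Qed.

Section Composition.
Variables (G H K : etale_groupoid).
Variables (beta : translation_action H K) (alpha : translation_action G H).

Definition ta_comp_anchor (d : arrow K) : base G :=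
  ta_base alpha (ta_base beta (rng d)).

Lemma ta_comp_subproof (g : arrow G) (d : arrow K)
    (e : src g = anchor alpha (unit_at (ta_base beta (rng d)))) :
  src (act e) = anchor beta d.
Proof. by rewrite ta_src_act src_unit -ta_baseE. Qed.

Definition ta_comp_act (g : arrow G) (d : arrow K)
  (e : src g = ta_comp_anchor d) : arrow K := act (ta_comp_subproof e).

Lemma ta_comp_anchor_continuous : continuous ta_comp_anchor.
Proof.
move=> d; apply: (@continuous_comp _ _ _ (@rng K) (ta_base alpha \o ta_base beta) d).
  exact: rng_continuous.
by apply: continuous_comp; exact: ta_base_continuous.
Qed.

Lemma ta_comp_act_continuous :
  continuous (fun x : fibered (@src G) ta_comp_anchor =>
    ta_comp_act (set_valP x)).
Proof.
pose D := fibered (@src G) ta_comp_anchor.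
have fstC : continuous (fun x : D => (val x).1).
  move=> x; apply: (@continuous_comp _ _ _ (val : D -> _) fst x).
    exact: initial_continuous.
  exact: cvg_fst.
have sndC : continuous (fun x : D => (val x).2).
  move=> x; apply: (@continuous_comp _ _ _ (val : D -> _) snd x).
    exact: initial_continuous.
  exact: cvg_snd.
pose f1 (x : D) : arrow G * arrow H :=
  ((val x).1, unit_at (ta_base beta (rng (val x).2))).
have f1P x : f1 x \in fibered (@src G) (anchor alpha).
  by apply/mem_set; exact: (set_valP x).
pose c1 (x : D) : fibered (@src G) (anchor alpha) := exist _ (f1 x) (f1P x).
have c1C : continuous c1.
  apply: continuous_comp_initial; apply: continuous_pair => [//|x].
  apply: (@continuous_comp _ _ _ (fun x : D => (val x).2)
    (fun d => unit_at (ta_base beta (rng d)))); first exact: sndC.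
  apply: (@continuous_comp _ _ _ (@rng K)
    (fun y => unit_at (ta_base beta y))); first exact: rng_continuous.
  by apply: continuous_comp; [exact: ta_base_continuous|exact: unit_continuous].
pose f2 (x : D) : arrow H * arrow K := (act (set_valP (c1 x)), (val x).2).
have f2P x : f2 x \in fibered (@src H) (anchor beta).
  by apply/mem_set; exact: ta_comp_subproof.
pose c2 (x : D) : fibered (@src H) (anchor beta) := exist _ (f2 x) (f2P x).
have c2C : continuous c2.
  apply: continuous_comp_initial; apply: continuous_pair => [x|//].
  apply: (@continuous_comp _ _ _ c1 (fun y => act (set_valP y)) x).
    exact: c1C.
  exact: act_continuous.
have -> : (fun x : D => ta_comp_act (set_valP x)) =
          (fun x => act (set_valP (c2 x))).
  by apply/funext => x; apply: act_congr => //; exact: act_congr.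
move=> x; apply: (@continuous_comp _ _ _ c2 (fun y => act (set_valP y)) x).
  exact: c2C.
exact: act_continuous.
Qed.

Definition ta_comp : translation_action G K.
Proof.
unshelve refine (@TranslationAction G K
  (@LeftAction G (arrow K) ta_comp_anchor ta_comp_act _ _ _ _ _) _ _ _).
- exact: ta_comp_anchor_continuous.
- exact: ta_comp_act_continuous.
- move=> g d e; rewrite /ta_comp_anchor /ta_comp_act.
  by rewrite -ta_baseE anchor_act -ta_baseE anchor_act.
- move=> h g d e1 e2 e3 e4; rewrite /ta_comp_act.
  set eta := act (e2 : src g = anchor alpha (unit_at (ta_base beta (rng d)))).
  have eh : src h = anchor alpha eta by rewrite anchor_act.
  set zeta := act (e4 : src h = anchor alpha (unit_at _)).
  have sz : src zeta = rng eta.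
    by rewrite /zeta ta_src_act src_unit -ta_baseE anchor_act.
  have eb : src eta = anchor beta d by exact: ta_comp_subproof.
  have eb' : src (gmul sz) = anchor beta d by rewrite src_mul.
  have eb'' : src zeta = anchor beta (act eb) by rewrite anchor_act.
  transitivity (act eb'); last first.
    by rewrite (act_mul eb' eb''); apply: act_congr => //; exact: act_congr.
  apply: act_congr => //.
  transitivity (act eh); first exact: act_mul.
  have eu : src (unit_at (ta_base beta (rng (ta_comp_act e2)))) = rng eta.
    by rewrite src_unit -ta_baseE anchor_act.
  have eh' : src h = anchor alpha (gmul eu) by rewrite mul_unitl.
  have e5 : src zeta = rng eta by [].
  transitivity (act eh'); first by apply: act_congr => //; rewrite mul_unitl.
  by rewrite -(ta_mul_act e5 eh'); exact: mul_congr.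
- move=> d e; rewrite /ta_comp_act.
  have e' : src (unit_at (ta_base beta (rng d))) = anchor beta d.
    by rewrite src_unit -ta_baseE.
  transitivity (act e'); last exact: act_unitl.
  by apply: act_congr => //; exact: act_unitl.
- by move=> z d e; rewrite /= /ta_comp_anchor rng_mul.
- by move=> g z e; exact: ta_src_act.
- move=> g z d e1 e2 e3 e4 /=.
  have eb : src (act (e1 : src g = anchor alpha (unit_at _))) = anchor beta (gmul e2).
    by rewrite ta_anchor_mul; exact: ta_comp_subproof.
  rewrite /ta_comp_act (ta_mul_act _ eb); apply: act_congr => //.
  by apply: act_congr => //; rewrite rng_mul.
Defined.

End Composition.

Record category := Category {
  obj :> Type;
  hom : obj -> obj -> Type;
  idm : forall a, hom a a;
  compm : forall a b c, hom b c -> hom a b -> hom a c;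
  compA : forall a b c d (h : hom c d) (g : hom b c) (f : hom a b),
    compm h (compm g f) = compm (compm h g) f;
  comp1m : forall a b (f : hom a b), compm (idm b) f = f;
  compm1 : forall a b (f : hom a b), compm f (idm a) = f
}.

Definition is_iso (C : category) (a b : C) (f : hom a b) : Prop :=
  exists g : hom b a, compm g f = idm a /\ compm f g = idm b.

Record functor (C D : category) := Functor {
  fobj :> C -> D;
  fhom : forall a b, hom a b -> hom (fobj a) (fobj b);
  fhom_id : forall a, fhom (idm a) = idm (fobj a);
  fhom_comp : forall a b c (g : hom b c) (f : hom a b),
    fhom (compm g f) = compm (fhom g) (fhom f)
}.

Definition functor_id (C : category) : functor C C :=
  @Functor C C id (fun _ _ f => f) (fun _ => erefl) (fun _ _ _ _ _ => erefl).

Definition functor_comp (C D E : category) (G : functor D E) (F : functor C D) :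
  functor C E.
Proof.
exists (G \o F) (fun a b f => fhom G (fhom F f)) => [a|a b c g f] /=.
  by rewrite !fhom_id.
by rewrite !fhom_comp.
Defined.

Definition naturally_isomorphic (C D : category) (F G : functor C D) : Prop :=
  exists eta : forall a, hom (F a) (G a),
    (forall a, is_iso (eta a)) /\
    (forall a b (f : hom a b), compm (eta b) (fhom F f) = compm (fhom G f) (eta a)).

Definition is_equivalence (C D : category) (F : functor C D) : Prop :=
  exists G : functor D C,
    naturally_isomorphic (functor_comp G F) (functor_id C) /\
    naturally_isomorphic (functor_comp F G) (functor_id D).

Definition pseudogroup_category : category.
Proof.
exists pseudogroup (fun P Q => continuous_morphism P Q) (fun P => cm_id P)
  cm_comp => *; exact: cm_ext.
Defined.

Lemma ta_compA (G H K L : etale_groupoid) (gamma : translation_action K L)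
    (beta : translation_action H K) (alpha : translation_action G H) :
  ta_comp gamma (ta_comp beta alpha) = ta_comp (ta_comp gamma beta) alpha.
Proof.
apply: ta_ext => [|g d e e'].
  apply/funext => d; rewrite /= /ta_comp_anchor /ta_base /= /ta_comp_anchor.
  by rewrite /ta_base /= !rng_unit.
rewrite /= /ta_comp_act /= /ta_comp_act /=.
apply: act_congr => //; apply: act_congr => //; apply: act_congr => //.
by rewrite /ta_base /= /ta_comp_anchor /ta_base /= !rng_unit.
Qed.

Lemma ta_comp1m (G H : etale_groupoid) (alpha : translation_action G H) :
  ta_comp (ta_id H) alpha = alpha.
Proof.
apply: ta_ext => [|g d e e'].
  apply/funext => d; rewrite [RHS]ta_baseE /= /ta_comp_anchor.
  by rewrite /ta_base /= !rng_unit.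
have e1 : src (unit_at (rng d)) = rng d by rewrite src_unit.
have e2 : src g = anchor alpha (gmul e1) by rewrite mul_unitl.
have e3 : src g = anchor alpha (unit_at (rng d)) by rewrite e' ta_baseE.
have e4 : src (act e3) = rng d by rewrite ta_src_act.
transitivity (gmul e4); last first.
  by rewrite (ta_mul_act e4 e2); apply: act_congr => //; rewrite mul_unitl.
rewrite /= /ta_comp_act /=; apply: mul_congr => //; apply: act_congr => //.
by rewrite /ta_base /= rng_unit.
Qed.

Lemma ta_compm1 (G H : etale_groupoid) (alpha : translation_action G H) :
  ta_comp alpha (ta_id G) = alpha.
Proof.
apply: ta_ext => [|g d e e'].
  by apply/funext => d; rewrite [RHS]ta_baseE /= /ta_comp_anchor /ta_base /= rng_unit.
by rewrite /= /ta_comp_act; apply: act_congr => //; exact: mul_unitr.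
Qed.

Definition groupoid_category : category :=
  @Category etale_groupoid translation_action ta_id ta_comp
    ta_compA ta_comp1m ta_compm1.

(* Main.v *)
Require Import Defs.
From mathcomp Require Import all_boot.
From mathcomp Require Import boolp classical_sets functions topology.

Set Implicit Arguments.
Unset Strict Implicit.
Unset Printing Implicit Defensive.

Local Open Scope classical_set_scope.

(** A continuous morphism [phi] and an action [alpha] are two descriptions of the
same data, because a point of [phi F] is determined by its source, and an
action commuting with right multiplication is determined by what it does to
units.

From [phi] to an action.  Let [q] be the spatial component.  Writing [F] as
[F * s(F)], as [r(F) * F], and [s(F)] as [F^-1 * F], and applying [phi], shows
that [phi] is monotone, that the source of [phi F] is the [q]-preimage of the
source of [F] ([cm_src]), and that [q] sends the range of [phi F] into the range
of [F] ([cm_rng]).  So if [src g = q y], each [phi F] with [F] containing [g] has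
exactly one point over [y]; two bisections containing [g] give the same point,
namely that of their intersection ([cm_lift_ex]).  This point [cm_lift] depends
on [g] and [y] only, and [g . d := cm_lift (g, rng d) d] is the formula of the
theorem.  Multiplicativity of [phi] gives associativity ([cm_lift_mul]), and
continuity holds because near a given point [cm_lift] runs through a fixed
bisection [phi F].

From an action to [phi].  Put [phi F := {g . y | g in F, y a unit}]
([act_units]).  Multiplicativity comes from
[(g h) . y = (g . rng (h . y)) (h . y)], unions are obvious.  The main point is
that [phi F] is a bisection ([act_units_bisection]).

The two constructions are inverse to each other since
[(g . rng d) d = g . d], and since a bisection contained in another one with the
same source equals it.  Functoriality is checked for the passage from actions
to morphisms, where it is an equality of sets, and transported through the
bijection.  The equivalence of categories is then formal: the functor from
actions to morphisms is bijective on hom-sets, and every pseudogroup is, by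
definition, that of some groupoid. *)

(** * Open sets and continuity on fibered products *)

Lemma openP_nbhd (T : topologicalType) (A : set T) :
  (forall x, A x -> exists B, [/\ open B, B x & B `<=` A]) -> open A.
Proof.
move=> AP; rewrite openE => x /AP[B [oB Bx BA]].
by rewrite /interior nbhsE; exists B.
Qed.

Lemma open_preimage (S T : topologicalType) (f : S -> T) (U : set T) :
  continuous f -> open U -> open (f @^-1` U).
Proof. by move=> cf; move: U; exact/continuousP. Qed.

Lemma fibered_continuous (S T B Z : topologicalType) (f : S -> B) (g : T -> B)
    (m : fibered f g -> Z) :
  (forall (x : fibered f g) (O : set Z), open O -> O (m x) ->
    exists A C, [/\ open A, open C, A (val x).1, C (val x).2 &
      forall y : fibered f g, A (val y).1 -> C (val y).2 -> O (m y)]) ->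
  continuous m.
Proof.
move=> mP; apply/continuousP => O oO; apply: openP_nbhd => x Ox.
have [A [C [oA oC Ax Cx AC]]] := mP x O oO Ox.
exists (val @^-1` (fst @^-1` A `&` snd @^-1` C)).
split=> [||y [Ay Cy]]; last exact: AC.
  apply: open_preimage; first exact: initial_continuous.
  by apply: openI; apply: open_preimage => // z; [exact: cvg_fst|exact: cvg_snd].
by split.
Qed.

(** * Bisections and their products with units *)

Section Bisections.
Variable G : etale_groupoid.
Implicit Types (F : bisection G) (g : arrow G) (U : set (base G)).

(** Intersect a neighborhood on which the source is injective with one on which
the range is. *)
Lemma bisection_ex g : exists F, pts F g.
Proof.
have [M [oM Mg _ [_ sM _]]] := src_local_homeo g.
have [N [oN Ng _ [_ rN _]]] := rng_local_homeo g.
have MN : is_bisection (M `&` N).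
  apply/is_bisectionP; split; first exact: openI.
    by move=> x y /set_mem[Mx _] /set_mem[My _]; exact: sM _ _ (mem_set Mx) (mem_set My).
  by move=> x y /set_mem[_ Nx] /set_mem[_ Ny]; exact: rN _ _ (mem_set Nx) (mem_set Ny).
by exists (Bisection MN); split.
Qed.

Lemma bisectionI_subproof F (O : set (arrow G)) :
  open O -> is_bisection (F `&` O).
Proof.
move=> oO; apply/is_bisectionP; split.
- by apply: openI => //; exact: bisection_open.
- by move=> x y /set_mem[Fx _] /set_mem[Fy _]; exact: src_bisection_inj Fx Fy.
- by move=> x y /set_mem[Fx _] /set_mem[Fy _]; exact: rng_bisection_inj Fx Fy.
Qed.

Definition bisectionI F (O : set (arrow G)) (oO : open O) : bisection G :=
  Bisection (bisectionI_subproof F oO).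

Lemma src_bisection_open F : open (@src G @` F).
Proof. by apply: src_open; exact: bisection_open. Qed.

Lemma rng_bisection_open F : open (@rng G @` F).
Proof. by apply: rng_open; exact: bisection_open. Qed.

Lemma mem_mul_unit F U (oU : open U) g :
  pts (pg_mul (F : bisections G) (unit_bisection oU)) g <->
  pts F g /\ U (src g).
Proof.
split=> [[a [b [e [Fa [x Ux bE] ->]]]]|[Fg Ug]].
  subst b.
  by rewrite mul_unitr; split => //; rewrite e rng_unit.
have e : src g = rng (unit_at (src g)) by rewrite rng_unit.
by exists g, (unit_at (src g)), e; split => //; [exists (src g)|rewrite mul_unitr].
Qed.

Lemma mem_unit_mul F U (oU : open U) g :
  pts (pg_mul (unit_bisection oU : bisections G) F) g <->
  pts F g /\ U (rng g).
Proof.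
split=> [[b [a [e [[x Ux bE] Fa ->]]]]|[Fg Ug]].
  subst b.
  by rewrite mul_unitl; split => //; rewrite -e src_unit.
have e : src (unit_at (rng g)) = rng g by rewrite src_unit.
by exists (unit_at (rng g)), g, e; split => //; [exists (rng g)|rewrite mul_unitl].
Qed.

Lemma mul_bisection_src F :
  pg_mul (F : bisections G) (unit_bisection (@src_bisection_open F)) = F.
Proof.
apply: bisection_ext; apply/seteqP; split=> g; first by move/mem_mul_unit => [].
by move=> Fg; apply/mem_mul_unit; split => //; exists g.
Qed.

Lemma mul_rng_bisection F :
  pg_mul (unit_bisection (@rng_bisection_open F) : bisections G) F = F.
Proof.
apply: bisection_ext; apply/seteqP; split=> g; first by move/mem_unit_mul => [].
by move=> Fg; apply/mem_unit_mul; split => //; exists g.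
Qed.

Lemma mul_inv_bisection F :
  pg_mul (pg_inv (F : bisections G)) F = unit_bisection (@src_bisection_open F).
Proof.
apply: bisection_ext; apply/seteqP; split.
  move=> _ [c [b [e [[a Fa cE] Fb ->]]]]; subst c.
  have ? : a = b by apply: (rng_bisection_inj Fa Fb); rewrite -e src_inv.
  by subst b; rewrite Defs.mulVg; exists (src a) => //; exists a.
move=> _ [_ [a Fa <-] <-].
have e : src (ginv a) = rng a by rewrite src_inv.
by exists (ginv a), a, e; split => //; [exists a|rewrite Defs.mulVg].
Qed.

End Bisections.

(** * From continuous morphisms to translation actions *)

Section MorphismToAction.
Variables G H : etale_groupoid.
Variable phi : continuous_morphism (bisections G) (bisections H).
Let q := spatial_component phi.

Let qE (U : set (base G)) (oU : open U) :
  pts (phi (unit_bisection oU)) = @unit_at H @` (q @^-1` U).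
Proof. by have [_] := spatial_componentP phi. Qed.

Let qE_bisection (U : set (base G)) (oU : open U) :
  phi (unit_bisection oU) =
  unit_bisection (open_preimage (spatial_componentP phi).1 oU).
Proof. by apply: bisection_ext; rewrite qE. Qed.

(** Inclusion is algebraic: [F] is the product of [F'] with the idempotent
[s(F)], and multiplying by an idempotent of the target only shrinks a set. *)
Lemma cm_le (F F' : bisection G) : F `<=` F' -> phi F `<=` phi F'.
Proof.
move=> FF' d.
have -> : F = pg_mul (F' : bisections G) (unit_bisection (@src_bisection_open _ F)).
  apply: bisection_ext; apply/seteqP; split=> g.
    by move=> Fg; apply/mem_mul_unit; split; [exact: FF'|exists g].
  move=> /mem_mul_unit[F'g [h Fh hg]].
  by rewrite -(src_bisection_inj (FF' _ Fh) F'g hg).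
by rewrite cm_mul qE_bisection => /mem_mul_unit[].
Qed.

(** One inclusion comes from [F = F * s(F)], the other from [s(F) = F^-1 * F],
which makes every unit over the preimage of [s(F)] a product ending with a point
of [phi F]. *)
Lemma cm_src (F : bisection G) :
  @src H @` phi F = q @^-1` (@src G @` F).
Proof.
apply/seteqP; split=> [_ [d Fd <-]|y Fqy].
  by move: Fd; rewrite -{1}(mul_bisection_src F) cm_mul qE_bisection
    => /mem_mul_unit[].
have : pts (phi (unit_bisection (@src_bisection_open _ F))) (unit_at y).
  by rewrite qE; exists y.
rewrite -mul_inv_bisection cm_mul => -[a [b [e [_ Fb yE]]]].
by exists b => //; rewrite -(src_mul e) -yE src_unit.
Qed.

Lemma cm_rng (F : bisection G) d :
  pts (phi F) d -> (@rng G @` F) (q (rng d)).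
Proof.
by rewrite -{1}(mul_rng_bisection F) cm_mul qE_bisection => /mem_unit_mul[].
Qed.

(** The point of [phi F] over [y] is the same for all bisections [F] containing
[g]: for two of them, compare with their intersection, which still contains [g],
using monotonicity and injectivity of the source. *)
Lemma cm_lift_ex g y : src g = q y ->
  exists d, src d = y /\ forall F : bisection G, pts F g -> pts (phi F) d.
Proof.
move=> gy; have inF (F : bisection G) : pts F g ->
    exists2 d, pts (phi F) d & src d = y.
  move=> Fg; have : (@src H @` phi F) y by rewrite cm_src; exists g.
  by [].
have [F Fg] := bisection_ex g; have [d Fd dy] := inF F Fg.
exists d; split => // F' F'g.
pose FF' := bisectionI F (bisection_open F').
have [d' FF'd d'y] := inF FF' (conj Fg F'g).
have -> : d = d'.
  apply: (src_bisection_inj Fd); last by rewrite d'y.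
  by apply: cm_le FF'd => ? [].
by apply: cm_le FF'd => ? [].
Qed.

(** [[phi F]_y] for any bisection [F] containing [g]. *)
Definition cm_lift g y (e : src g = q y) : arrow H := sval (cid (cm_lift_ex e)).

Lemma src_cm_lift g y (e : src g = q y) : src (cm_lift e) = y.
Proof. by rewrite /cm_lift; case: cid => d []. Qed.

Lemma cm_lift_mem g y (e : src g = q y) (F : bisection G) :
  pts F g -> pts (phi F) (cm_lift e).
Proof. by move=> Fg; rewrite /cm_lift; case: cid => d /= [_ /(_ F Fg)]. Qed.

Lemma cm_liftE g y (e : src g = q y) (F : bisection G) d :
  pts F g -> pts (phi F) d -> src d = y -> cm_lift e = d.
Proof.
move=> Fg Fd dy; apply: (src_bisection_inj (cm_lift_mem e Fg) Fd).
by rewrite src_cm_lift.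
Qed.

(** For any bisection [F] containing [g], [q (rng (cm_lift e))] lies in the range of
[F].  Such ranges can be made to lie in any neighborhood of [rng g], and points of
the Hausdorff base are separated by neighborhoods. *)
Lemma cm_lift_rng g y (e : src g = q y) : q (rng (cm_lift e)) = rng g.
Proof.
apply: contrapT => /eqP qg.
have := @base_hausdorff G; rewrite open_hausdorff => /(_ _ _ qg).
move=> [[A B] /= [/set_mem Aq /set_mem Bg] [oA oB /eqP AB]].
have [F Fg] := bisection_ex g.
have oB' : open (@rng G @^-1` B) by apply: open_preimage => //; exact: rng_continuous.
have FBg : pts (bisectionI F oB') g by split.
have [h [_ Bh] hE] := cm_rng (cm_lift_mem e FBg).
suff : set0 (q (rng (cm_lift e))) by [].
by rewrite -AB; split => //; rewrite -hE.
Qed.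

(** With bisections [F] and [F'] around [g] and [h], the product of the two lifts
lies in [phi F' * phi F = phi (F' * F)]. *)
Lemma cm_lift_mul h g y (e1 : src h = rng g) (e : src g = q y)
    (e' : src (gmul e1) = q y) (e'' : src h = q (rng (cm_lift e)))
    (e2 : src (cm_lift e'') = rng (cm_lift e)) :
  cm_lift e' = gmul e2.
Proof.
have [F Fg] := bisection_ex g; have [F' F'h] := bisection_ex h.
apply: (cm_liftE _ (F := pg_mul (F' : bisections G) (F : bisections G))).
- by exists h, g, e1.
- rewrite cm_mul; exists (cm_lift e''), (cm_lift e), e2.
  by split => //; exact: cm_lift_mem.
- by rewrite src_mul src_cm_lift.
Qed.

Lemma cm_lift_unit y (e : src (unit_at (q y)) = q y) :
  cm_lift e = unit_at y.
Proof.
apply: (cm_liftE _ (F := unit_bisection openT)); last by rewrite src_unit.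
  by exists (q y).
by rewrite qE; exists y.
Qed.

Lemma cm_lift_congr g g' y y' (e : src g = q y) (e' : src g' = q y') :
  g = g' -> y = y' -> cm_lift e = cm_lift e'.
Proof.
by move=> gg' yy'; subst g' y'; congr cm_lift; exact: Prop_irrelevance.
Qed.

Definition cm_anchor (d : arrow H) : base G := q (rng d).

Definition cm_act (g : arrow G) (d : arrow H) (e : src g = cm_anchor d) :
  arrow H := gmul (src_cm_lift (e : src g = q (rng d))).

Lemma cm_anchor_continuous : continuous cm_anchor.
Proof.
move=> d; apply: (@continuous_comp _ _ _ (@rng H) q).
  exact: rng_continuous.
by have [+ _] := spatial_componentP phi; apply.
Qed.

(** Fix a bisection [F] containing [g].  On [F] the lift over [y] is the point of
[phi F] over [y]; it stays in a neighborhood [A] of its value as long as [y] stays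
in the source of [phi F `&` A], which is open because the source map is. *)
Lemma cm_act_continuous :
  continuous (fun x : fibered (@src G) cm_anchor => cm_act (set_valP x)).
Proof.
apply: fibered_continuous => x O oO Ox.
set g := (val x).1; set z := (val x).2.
have e : src g = q (rng z) by exact: set_valP x.
have {}Ox : O (gmul (src_cm_lift e)).
  by move: Ox; congr (O _); apply: mul_congr => //; exact: cm_lift_congr.
have [A [C [oA oC Ae Cz AC]]] := mul_nbhs oO Ox.
have [F Fg] := bisection_ex g.
pose W := @src H @` (phi F `&` A).
have oW : open W by apply: src_open; apply: openI => //; exact: bisection_open.
exists F, (C `&` @rng H @^-1` W); split => //.
- exact: bisection_open.
- by apply: openI => //; apply: open_preimage => //; exact: rng_continuous.
- split => //; exists (cm_lift e); last by rewrite src_cm_lift.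
  by split => //; exact: cm_lift_mem.
move=> y Fy [Cy [d [Fd Ad] dy]]; apply: AC => //.
by rewrite (cm_liftE _ Fy Fd dy).
Qed.

Definition action_of_cm : translation_action G H.
Proof.
unshelve refine (@TranslationAction G H
  (@LeftAction G (arrow H) cm_anchor cm_act _ _ _ _ _) _ _ _).
- exact: cm_anchor_continuous.
- exact: cm_act_continuous.
- by move=> g z e; rewrite /cm_anchor /cm_act rng_mul cm_lift_rng.
- move=> h g z e1 e2 e3 e4; rewrite /cm_act.
  have e4' : src h = q (rng (cm_lift e2)) by rewrite e1 cm_lift_rng.
  have e5 : src (cm_lift e4') = rng (cm_lift e2) by rewrite src_cm_lift.
  have e6 : src (gmul e5) = rng z by rewrite src_mul src_cm_lift.
  transitivity (gmul e6).
    by apply: mul_congr => //; exact: cm_lift_mul.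
  have e7 : src (cm_lift e4') = rng (cm_act e2).
    by rewrite src_cm_lift /cm_act rng_mul.
  rewrite (mulA e6 e7); apply: mul_congr => //; apply: cm_lift_congr => //.
  by rewrite rng_mul.
- move=> z e; rewrite /cm_act.
  have e1 : src (unit_at (rng z)) = rng z by rewrite src_unit.
  by rewrite (mul_congr _ e1) ?mul_unitl// cm_lift_unit.
- by move=> z d e; rewrite /= /cm_anchor rng_mul.
- by move=> g z e; exact: src_mul.
- move=> g z d e1 e2 e3 e4; rewrite /= /cm_act.
  have e5 : src (cm_lift (e1 : src g = q (rng z))) = rng (gmul e2).
    by rewrite src_cm_lift rng_mul.
  rewrite (mulA e3 e5); apply: mul_congr => //; apply: cm_lift_congr => //.
  by rewrite rng_mul.
Defined.

Lemma action_of_cmE (F : bisection G) (g : arrow G) (d : arrow H)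
    (e : src g = anchor action_of_cm d) :
  pts F g ->
  exists hx : (@src H @` pts (phi F)) (rng d),
    act e = gmul (src_section_at hx).
Proof.
move=> Fg; have Fl := cm_lift_mem e Fg; have sl := src_cm_lift e.
have hx : (@src H @` pts (phi F)) (rng d) by exists (cm_lift e).
exists hx; apply: mul_congr => //.
by apply: (cm_liftE e Fg); [exact: section_at_mem|exact: src_section_at].
Qed.

End MorphismToAction.

Lemma act_invK (G : etale_groupoid) (Z : topologicalType)
    (alpha : left_action G Z) g z (e : src g = anchor alpha z)
    (e' : src (ginv g) = anchor alpha (act e)) : act e' = z.
Proof.
have e1 : src (ginv g) = rng g by rewrite src_inv.
have e2 : src (gmul e1) = anchor alpha z by rewrite src_mul.
rewrite -(act_mul e2 e').
have e3 : src (unit_at (src g)) = anchor alpha z by rewrite src_unit.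
by rewrite (act_congr e2 e3) ?act_unitl ?Defs.mulVg.
Qed.

Lemma act_nbhs (G : etale_groupoid) (Z : topologicalType)
    (alpha : left_action G Z) g z (e : src g = anchor alpha z) (O : set Z) :
  open O -> O (act e) ->
  exists A C, [/\ open A, open C, A g, C z &
    forall a c (e' : src a = anchor alpha c), A a -> C c -> O (act e')].
Proof.
move=> oO Oe.
have gz : (g, z) \in fibered (@src G) (anchor alpha) by exact/mem_set.
pose x : fibered (@src G) (anchor alpha) := exist _ (g, z) gz.
have Ox : O (act (set_valP x)) by rewrite (act_congr _ e).
have [A [C [oA oC Ag Cz H]]] := fibered_nbhs (@act_continuous _ _ alpha) oO Ox.
exists A, C; split => // a c e' Aa Cc.
have ac : (a, c) \in fibered (@src G) (anchor alpha) by exact/mem_set.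
have := H (exist _ (a, c) ac) Aa Cc.
by rewrite (act_congr _ e').
Qed.

(** * From translation actions to continuous morphisms *)

Section ActionToMorphism.
Variables G H : etale_groupoid.
Variable alpha : translation_action G H.
Implicit Types F : bisection G.

(** Commutation with right multiplication, applied to [z = rng z * z]. *)
Lemma act_unit_at g z (e : src g = anchor alpha z)
    (e1 : src g = anchor alpha (unit_at (rng z))) (e2 : src (act e1) = rng z) :
  act e = gmul e2.
Proof.
have e3 : src (unit_at (rng z)) = rng z by rewrite src_unit.
have e4 : src g = anchor alpha (gmul e3) by rewrite mul_unitl.
by rewrite (ta_mul_act e2 e4); apply: act_congr => //; rewrite mul_unitl.
Qed.

(** [act e] is [(g . rng z) z], whose range is that of [g . rng z]. *)
Lemma rng_act g z z' (e : src g = anchor alpha z) (e' : src g = anchor alpha z') :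
  rng z = rng z' -> rng (act e) = rng (act e').
Proof.
move=> zz'.
have e1 : src g = anchor alpha (unit_at (rng z)).
  by rewrite e !ta_baseE rng_unit.
have e2 : src g = anchor alpha (unit_at (rng z')) by rewrite -zz'.
have e3 : src (act e1) = rng z by rewrite ta_src_act src_unit.
have e4 : src (act e2) = rng z' by rewrite ta_src_act src_unit.
rewrite (act_unit_at e e3) (act_unit_at e' e4) !rng_mul.
by congr rng; apply: act_congr => //; rewrite zz'.
Qed.

Definition act_units (F : set (arrow G)) : set (arrow H) :=
  [set d | exists g y (e : src g = anchor alpha (unit_at y)), F g /\ d = act e].

(** A point [d] of [act_units F] is [g . y] for the only [g] in [F] with range
[anchor alpha d], and [y] is then recovered as [g^-1 . d].  So membership of [d]
means that [g^-1 . d] is a unit, which is an open condition because units form an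
open set.  Injectivity of the range map comes from the same recovery, since [d]
enters the range of [g^-1 . d] only through its own range. *)
Lemma act_units_bisection F : is_bisection (act_units F).
Proof.
apply/is_bisectionP; split.
- apply: openP_nbhd => _ [g [y [e [Fg ->]]]].
  have e' : src (ginv g) = anchor alpha (act e) by rewrite src_inv anchor_act.
  (* [g^-1 . (g . y) = y] is a unit, and so are all nearby products. *)
  have : (range (@unit_at H)) (act e') by rewrite act_invK; exists y.
  move=> /(act_nbhs (unit_open openT))[A [C [oA oC Ag Cd AC]]].
  pose N := F `&` @ginv G @^-1` A.
  exists (C `&` anchor alpha @^-1` (@rng G @` N)); split.
  + apply: openI => //; apply: open_preimage; first exact: anchor_continuous.
    apply: rng_open; apply: openI; first exact: bisection_open.
    by apply: open_preimage => //; exact: inv_continuous.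
  + by split => //; exists g => //; rewrite anchor_act.
  move=> d [Dd [h [Fh Ah] hd]].
  have e1 : src (ginv h) = anchor alpha d by rewrite src_inv.
  have [x _ xE] := AC _ _ e1 Ah Dd.
  have e2 : src h = anchor alpha (unit_at x) by rewrite xE anchor_act rng_inv.
  exists h, x, e2; split => //.
  have e3 : src (ginv (ginv h)) = anchor alpha (act e1) by rewrite Defs.invK -xE.
  by rewrite -(act_invK e3); apply: act_congr; rewrite ?Defs.invK ?xE.
- move=> _ _ /set_mem[g [y [e [Fg ->]]]] /set_mem[g' [y' [e' [Fg' ->]]]].
  rewrite !ta_src_act !src_unit => yy'; subst y'; apply: act_congr => //.
  by apply: (src_bisection_inj Fg Fg'); rewrite e.
- move=> _ _ /set_mem[g [y [e [Fg ->]]]] /set_mem[g' [y' [e' [Fg' ->]]]] rr.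
  have ? : g = g'.
    apply: (rng_bisection_inj Fg Fg').
    by rewrite -(anchor_act e) -(anchor_act e') !ta_baseE rr.
  subst g'; apply: act_congr => //; congr unit_at.
  have i : src (ginv g) = anchor alpha (act e) by rewrite src_inv anchor_act.
  have i' : src (ginv g) = anchor alpha (act e') by rewrite src_inv anchor_act.
  by have := rng_act i i' rr; rewrite !act_invK !rng_unit.
Qed.

Definition cm_of_action_fun (F : bisections G) : bisections H :=
  Bisection (act_units_bisection F).

Definition cm_of_action : continuous_morphism (bisections G) (bisections H).
Proof.
exists cm_of_action_fun.
- move=> F F'; apply: bisection_ext; apply/seteqP; split.
    move=> _ [h [y [e [[a [b [ab [Fa Fb hE]]]] ->]]]]; subst h.
    have eb : src b = anchor alpha (unit_at y) by rewrite -e src_mul.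
    have ea : src a = anchor alpha (act eb) by rewrite anchor_act.
    have ea1 : src a = anchor alpha (unit_at (rng (act eb))).
      by rewrite ea !ta_baseE rng_unit.
    have ea2 : src (act ea1) = rng (act eb) by rewrite ta_src_act src_unit.
    rewrite (act_mul e ea) (act_unit_at ea ea2).
    exists (act ea1), (act eb), ea2; split => //.
      by exists a, (rng (act eb)), ea1.
    by exists b, y, eb.
  move=> _ [h [k [e [[a [x [ea [Fa hE]]]] [b [y [eb [Fb kE]]]] ->]]]].
  subst h k.
  have xE : x = rng (act eb) by rewrite -e ta_src_act src_unit.
  subst x; have ea' : src a = anchor alpha (act eb).
    by rewrite ea !ta_baseE rng_unit.
  have ab : src a = rng b by rewrite ea' anchor_act.
  have eab : src (gmul ab) = anchor alpha (unit_at y) by rewrite src_mul.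
  exists (gmul ab), y, eab; split; first by exists a, b, ab.
  by rewrite (act_mul eab ea') (act_unit_at ea' e).
- move=> C F cC /= FE; rewrite FE; apply/seteqP; split.
    move=> _ [g [y [e [[S CS Sg] ->]]]].
    by exists (cm_of_action_fun S); [exists S|exists g, y, e].
  move=> _ [_ [S CS <-] [g [y [e [Sg ->]]]]].
  by exists g, y, e; split => //; exists S.
- apply: bisection_ext; apply/seteqP; split => // d [g [y [e []]]].
  by [].
- apply: bisection_ext; apply/seteqP; split.
    move=> _ [h [y [e [[x _ hE] ->]]]]; subst h.
    by rewrite act_unitl; exists y.
  move=> _ [y _ <-].
  have e : src (unit_at (anchor alpha (unit_at y))) = anchor alpha (unit_at y).
    by rewrite src_unit.
  exists (unit_at (anchor alpha (unit_at y))), y, e.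
  by rewrite act_unitl; split => //; exists (anchor alpha (unit_at y)).
Defined.

Lemma spatial_cm_of_action : spatial_component cm_of_action = ta_base alpha.
Proof.
have [q [_ qU]] := spatial_component_ex cm_of_action.
rewrite -(qU _ (spatial_componentP cm_of_action)); apply: qU.
split=> [|U oU]; first exact: ta_base_continuous.
apply/seteqP; split.
  move=> _ [h [y [e [[x Ux hE] ->]]]]; subst h.
  by rewrite act_unitl; exists y => //; rewrite /preimage /= /ta_base /= -e src_unit.
move=> _ [y Uy <-].
have e : src (unit_at (ta_base alpha y)) = anchor alpha (unit_at y).
  by rewrite src_unit.
exists (unit_at (ta_base alpha y)), y, e.
by rewrite act_unitl; split => //; exists (ta_base alpha y).
Qed.

(** Both actions send [z] to [(g . rng z) z]. *)
Lemma cm_of_actionK : action_of_cm cm_of_action = alpha.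
Proof.
apply: ta_ext => [|g z e e'].
  by apply/funext => d; rewrite /= /cm_anchor spatial_cm_of_action -ta_baseE.
have e1 : src g = anchor alpha (unit_at (rng z)).
  by rewrite e' !ta_baseE rng_unit.
have e2 : src (act e1) = rng z by rewrite ta_src_act src_unit.
rewrite (act_unit_at e' e2); apply: mul_congr => //.
have [F Fg] := bisection_ex g.
apply: (cm_liftE _ (F := F)) => //.
by exists g, (rng z), e1.
Qed.

End ActionToMorphism.

(** On units the action of [phi] is [cm_lift], so the set attached to [F] is
contained in [phi F]; both have the same source by [cm_src]. *)
Lemma action_of_cmK (G H : etale_groupoid)
    (phi : continuous_morphism (bisections G) (bisections H)) :
  cm_of_action (action_of_cm phi) = phi.
Proof.
have actE g y (e : src g = anchor (action_of_cm phi) (unit_at y))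
    (e' : src g = spatial_component phi y) : act e = cm_lift e'.
  have e1 : src (cm_lift e') = rng (unit_at y) by rewrite src_cm_lift rng_unit.
  rewrite -(mul_unitr e1); apply: mul_congr => //; apply: cm_lift_congr => //.
  by rewrite rng_unit.
have anchorE y : anchor (action_of_cm phi) (unit_at y) = spatial_component phi y.
  by rewrite /= /cm_anchor rng_unit.
apply: cm_ext => F; apply: bisection_ext; apply/seteqP; split.
  move=> _ [g [y [e [Fg ->]]]]; have e' := e; rewrite anchorE in e'.
  by rewrite (actE _ _ e e'); exact: cm_lift_mem.
move=> d Fd; have : (@src H @` phi F) (src d) by exists d.
rewrite cm_src => -[g Fg gd].
have e : src g = anchor (action_of_cm phi) (unit_at (src d)) by rewrite anchorE.
by exists g, (src d), e; split => //; rewrite (actE _ _ e gd) (cm_liftE gd Fg Fd).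
Qed.

Lemma cm_of_action_id (G : etale_groupoid) :
  cm_of_action (ta_id G) = cm_id (bisections G).
Proof.
apply: cm_ext => F; apply: bisection_ext; apply/seteqP; split.
  by move=> _ [g [y [e [Fg ->]]]]; rewrite /= mul_unitr.
move=> g Fg; have e : src g = rng (unit_at (src g)) by rewrite rng_unit.
by exists g, (src g), e; split => //; rewrite /= mul_unitr.
Qed.

Lemma cm_of_action_comp (G H K : etale_groupoid)
    (beta : translation_action H K) (alpha : translation_action G H) :
  cm_of_action (ta_comp beta alpha) =
  cm_comp (P := pseudogroup_of G) (Q := pseudogroup_of H)
    (R := pseudogroup_of K) (cm_of_action beta) (cm_of_action alpha).
Proof.
have baseE z : ta_base beta (rng (unit_at z)) = anchor beta (unit_at z).
  by rewrite -ta_baseE.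
apply: cm_ext => F; apply: bisection_ext; apply/seteqP; split.
  move=> _ [g [z [e [Fg ->]]]].
  have e1 : src g = anchor alpha (unit_at (anchor beta (unit_at z))).
    by rewrite e /= /ta_comp_anchor baseE.
  have e2 : src (act e1) = anchor beta (unit_at z) by rewrite ta_src_act src_unit.
  exists (act e1), z, e2; split; first by exists g, (anchor beta (unit_at z)), e1.
  rewrite /= /ta_comp_act; apply: act_congr => //.
by apply: act_congr => //; rewrite baseE.
move=> _ [h [z [e2 [[g [y [e1 [Fg hE]]]] ->]]]]; subst h.
have yE : y = anchor beta (unit_at z) by rewrite -e2 ta_src_act src_unit.
subst y; have e : src g = anchor (ta_comp beta alpha) (unit_at z).
  by rewrite e1 /= /ta_comp_anchor baseE.
exists g, z, e; split => //.
rewrite /= /ta_comp_act; apply: act_congr => //.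
by apply: act_congr => //; rewrite baseE.
Qed.

(** * Equivalence of categories *)

(** The usual quasi-inverse: choose [c d] with an isomorphism [t d] from [F (c d)]
to [d], conjugate by [t] and apply [lift].  The natural isomorphisms are [t]
itself and [lift] of [t] at the objects [F a]. *)
Lemma fully_faithful_equivalence (C D : category) (F : functor C D)
    (lift : forall a b, hom (F a) (F b) -> hom a b) :
  (forall a b, cancel (@fhom _ _ F a b) (@lift a b)) ->
  (forall a b, cancel (@lift a b) (@fhom _ _ F a b)) ->
  (forall d, exists c (t : hom (F c) d), is_iso t) ->
  is_equivalence F.
Proof.
move=> FK liftK Fsurj.
pose c d : C := projT1 (cid (Fsurj d)).
pose t d : hom (F (c d)) d := projT1 (cid (projT2 (cid (Fsurj d)))).
have tP d : is_iso (t d) := projT2 (cid (projT2 (cid (Fsurj d)))).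
pose u d : hom d (F (c d)) := projT1 (cid (tP d)).
have [ut tu] : (forall d, compm (u d) (t d) = idm (F (c d))) /\
    (forall d, compm (t d) (u d) = idm d).
  by split=> d; have [] := projT2 (cid (tP d)).
have lift_id a : lift a a (idm (F a)) = idm a by rewrite -fhom_id FK.
have lift_comp a b e (g : hom (F b) (F e)) (f : hom (F a) (F b)) :
    lift _ _ (compm g f) = compm (lift _ _ g) (lift _ _ f).
  by rewrite -{1}(liftK _ _ g) -{1}(liftK _ _ f) -fhom_comp FK.
pose Ghom a b (f : hom a b) : hom (c a) (c b) :=
  lift _ _ (compm (u b) (compm f (t a))).
have G1 a : Ghom a a (idm a) = idm (c a) by rewrite /Ghom comp1m ut lift_id.
have GM a b e (g : hom b e) (f : hom a b) :
    Ghom _ _ (compm g f) = compm (Ghom _ _ g) (Ghom _ _ f).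
  rewrite /Ghom -lift_comp; congr lift.
  by rewrite -!Defs.compA (Defs.compA (t b)) tu comp1m.
exists (Functor G1 GM); split.
  exists (fun a => lift _ _ (t (F a))); split=> [a|a b f] /=.
    exists (lift _ _ (u (F a))).
    by rewrite -!lift_comp ut tu !lift_id.
  rewrite /Ghom -{2}(FK _ _ f) -!lift_comp; congr lift.
  by rewrite Defs.compA tu comp1m.
exists t; split=> [d|a b f] /=; first exact: tP.
by rewrite /Ghom liftK Defs.compA tu comp1m.
Qed.

(** The isomorphism is an identity: [P] and [pseudogroup_of G] differ at most in
the proof that their common data comes from a groupoid. *)
Lemma pseudogroup_iso_bisections (P : pseudogroup_category) :
  exists (G : groupoid_category)
    (t : @hom pseudogroup_category (pseudogroup_of G) P), is_iso t.
Proof.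
case: P => P [G PE]; subst P; exists G, (cm_id (bisections G)).
by exists (cm_id (bisections G)); split; exact: cm_ext.
Qed.

Theorem theorem4p19 :
  exists (Phi : forall G H : etale_groupoid,
            continuous_morphism (bisections G) (bisections H) ->
            translation_action G H)
         (Psi : forall G H : etale_groupoid,
            translation_action G H ->
            continuous_morphism (bisections G) (bisections H)),
  [/\ (forall G H, cancel (Phi G H) (Psi G H) /\ cancel (Psi G H) (Phi G H)),
      (forall G H (phi : continuous_morphism (bisections G) (bisections H)),
        anchor (Phi G H phi) = spatial_component phi \o @rng H /\
        forall (F : bisection G) (g : arrow G) (d : arrow H)
               (e : src g = anchor (Phi G H phi) d),
          pts F g ->
          exists hx : (@src H @` pts (phi F)) (rng d),
            act e = gmul (src_section_at hx)),
      (forall G, Phi G G (cm_id (bisections G)) = ta_id G),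
      (forall G H K (psi : continuous_morphism (bisections H) (bisections K))
                    (phi : continuous_morphism (bisections G) (bisections H)),
        Phi G K (cm_comp (P := pseudogroup_of G) (Q := pseudogroup_of H)
                         (R := pseudogroup_of K) psi phi) =
        ta_comp (Phi H K psi) (Phi G H phi)) &
      exists Psi_id Psi_comp,
        is_equivalence (@Functor groupoid_category pseudogroup_category
                          pseudogroup_of Psi Psi_id Psi_comp)].
Proof.
exists action_of_cm, cm_of_action; split.
- by move=> G H; split=> ?; [exact: action_of_cmK|exact: cm_of_actionK].
- by move=> G H phi; split => // F g d e; exact: action_of_cmE.
- by move=> G; rewrite -cm_of_action_id cm_of_actionK.
- move=> G H K psi phi.
  rewrite -{1}(action_of_cmK psi) -{1}(action_of_cmK phi).
  by rewrite -cm_of_action_comp cm_of_actionK.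
- exists cm_of_action_id, cm_of_action_comp.
  apply: (@fully_faithful_equivalence groupoid_category pseudogroup_category
    (@Functor groupoid_category pseudogroup_category pseudogroup_of
      cm_of_action cm_of_action_id cm_of_action_comp) action_of_cm).
  + exact: cm_of_actionK.
  + exact: action_of_cmK.
  + exact: pseudogroup_iso_bisections.
Qed.
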